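(* Let $C:y=y(x)$ be a smooth curve in $A^2$ and let $P=(x,y(x))$ be a regular point of $C$. Then the curvature of $C$ at $P$ is $$k(x)=\frac{\sqrt3\,(9y_{xx}^2y_{xxxxx}-45y_{xx}y_{xxx}y_{xxxx}+40y_{xxx}^3)}{3\,|3y_{xx}y_{xxxx}-5y_{xxx}^2|^{3/2}}.$$
   Context: $A^2$ is the real affine plane with affine coordinates $(x,y)$. Subscripts $x$ denote derivatives of $y(x)$. A point $P$ of $C$ is regular if $S_1=y_{xx}\ne0$ and $S_2=3y_{xx}y_{xxxx}-5y_{xxx}^2\neq0$ at $P$. For a regular point $P$ there is a unique affine transformation $g:Z\mapsto A(Z-P)$ with $\det A>0$ such that $gC$ is, near the origin, a graph $y'=y'(x')$ whose derivatives at the origin satisfy $y'=y'_{x'}=y'_{x'x'x'}=0$, $y'_{x'x'}=1$ and $y'_{x'x'x'x'}=\pm1$ (at $x'=0$). The curvature of $C$ at $P$ is by definition the invariantization of $y_{xxxxx}$, i.e. the value at $x'=0$ of the fifth derivative $y'_{x'x'x'x'x'}$ of this normalized curve $gC$. *)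

(* Defs.v *)
From HB Require Import structures.
From mathcomp Require Import all_boot all_order all_algebra.
From mathcomp Require Import all_classical all_reals all_analysis.

Set Implicit Arguments.
Unset Strict Implicit.
Unset Printing Implicit Defensive.

Import Order.TTheory GRing.Theory Num.Theory.
Import numFieldNormedType.Exports.

Local Open Scope classical_set_scope.
Local Open Scope ring_scope.

(* Points of the affine plane are column vectors Z : 'cV[R]_2, with
   coordinates x = Z 0 0 and y = Z 1 0. *)
Definition pt {R : realType} (a b : R) : 'cV[R]_2 :=
  \col_(i < 2) (if i == 0 then a else b).

Definition graph_over {R : realType} (I : set R) (y : R -> R) : set 'cV[R]_2 :=
  [set pt t (y t) | t in I].

(* [derivable] is two-sided, so this is the usual notion of a C^infinity
   function when D is open. *)
Definition smooth_on {R : realType} (D : set R) (f : R -> R) : Prop :=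
  forall (n : nat) (t : R), D t -> derivable (derive1n n f) t 1.

Definition S1 {R : realType} (y : R -> R) (x : R) : R := derive1n 2 y x.

Definition S2 {R : realType} (y : R -> R) (x : R) : R :=
  3 * derive1n 2 y x * derive1n 4 y x - 5 * derive1n 3 y x ^+ 2.

Definition regular {R : realType} (y : R -> R) (x : R) : Prop :=
  S1 y x != 0 /\ S2 y x != 0.

Definition affine_map {R : realType} (A : 'M[R]_2) (P : 'cV[R]_2) :
  'cV[R]_2 -> 'cV[R]_2 := fun Z => A *m (Z - P).

(* Only the germ of Y at 0 matters here. *)
Definition near_origin_graph {R : realType} (S : set 'cV[R]_2) (Y : R -> R) :
    Prop :=
  (exists2 U : set R, nbhs 0 U & smooth_on U Y) /\
  (\forall Z \near (0 : 'cV[R]_2), S Z <-> Z 1 0 = Y (Z 0 0)).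

Definition normalized {R : realType} (Y : R -> R) : Prop :=
  [/\ Y 0 = 0,
      derive1n 1 Y 0 = 0,
      derive1n 2 Y 0 = 1,
      derive1n 3 Y 0 = 0 &
      derive1n 4 Y 0 = 1 \/ derive1n 4 Y 0 = - 1].

(* A relation rather than a function of (C, P): no such k exists where C is a
   graph with S1 = 0 or S2 = 0. *)
Definition is_affine_curvature {R : realType} (C : set 'cV[R]_2)
    (P : 'cV[R]_2) (k : R) : Prop :=
  exists (A : 'M[R]_2) (Y : R -> R),
    [/\ 0 < \det A,
        near_origin_graph (affine_map A P @` C) Y,
        normalized Y &
        derive1n 5 Y 0 = k].

(* Main.v *)
Require Import Defs.
From mathcomp Require Import all_boot all_order all_algebra.
From mathcomp Require Import all_classical all_reals all_analysis.
From mathcomp Require Import ring lra.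
Import Order.TTheory GRing.Theory Num.Theory.
Import numFieldNormedType.Exports.
Local Open Scope classical_set_scope.
Local Open Scope ring_scope.

Set Implicit Arguments.
Unset Strict Implicit.
Unset Printing Implicit Defensive.

(** Let [g : Z |-> A (Z - P)] and let [F t], [K t] be the two coordinates of
    [g (t, y t)].  That [g C] is the graph of [Y] near the origin means
    [K = Y \o F] near [x].  Differentiating this identity five times
    ([faa_di_bruno5]) gives a triangular system linking the derivatives of [y]
    at [x], the entries of [A] and the derivatives of [Y] at [0].

    Write [q, r, s, w] for the derivatives of [y] of orders 2 to 5, and
    [u = F' x].  The normalizations of orders one, two and three express the
    matrix [A] through [u] and the jet of [y].  The normalization of order four
    becomes [3 (q u)^2 = |3 q s - 5 r^2|], and [det A > 0] forces [q u > 0], so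
    [u] too is determined.  The equation of order five then reads
    [9 (q u)^3 k = 9 q^2 w - 45 q r s + 40 r^3], which is the formula
    ([normal_form_curvature], [affine_curvature_value]).

    For existence, the same equations are used to choose [A]
    ([normal_form_exists]).  As [u <> 0], the abscissa [F] has a local inverse
    [h] and [g C] is locally the graph of [K \o h]
    ([near_origin_graph_inverse]).  Smoothness of [K \o h] is obtained by
    exhibiting an algebra of functions containing it that is stable under
    derivation ([smooth_local_inverse]).  Since at most one value of the
    curvature is possible, existence of some curvature also shows that the
    value given by the formula is attained. *)

(** * Towers of derivatives *)

(** One neighbourhood of [t] serves all orders of derivation, so a tower is the
    germ of a smooth function given with explicit derivatives; any formula for
    the [F n] may be used instead of iterating [derive1]. *)
Definition derivative_tower {R : realType} (t : R) (F : nat -> R -> R) : Prop :=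
  \forall s \near t, forall n, is_derive s (1 : R) (F n) (F n.+1 s).

Lemma smooth_on_tower (R : realType) (D : set R) (f : R -> R) (t : R) :
  nbhs t D -> smooth_on D f -> derivative_tower t (fun n => derive1n n f).
Proof.
move=> Dt fD; near=> s => n.
have Ds : D s by near: s.
by rewrite derive1nS derive1E; apply/derivableP; exact: fD.
Unshelve. all: by end_near. Qed.

(** The step from one derivative to infinitely many: membership in [C] is
    preserved by derivation on [D], hence by iterated derivation.  Smoothness
    of a composite or of an inverse then reduces to exhibiting a class of
    functions stable under a single derivation. *)
Lemma smooth_on_derivation_closed (R : realType) (D : set R)
    (C : set (R -> R)) :
  open D ->
  (forall h, C h -> exists2 h', C h' &
     forall s, D s -> is_derive s 1 h (h' s)) ->
  forall h, C h -> smooth_on D h.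
Proof.
move=> Dop CD h Ch n.
have near_eq (f g : R -> R) (t : R) : (forall s, D s -> f s = g s) -> D t ->
    \near t, f t = g t.
  by move=> fg Dt; near=> s; apply: fg; near: s; exact: open_nbhs_nbhs.
have [hn [Chn hnE]] :
    exists hn, C hn /\ forall s, D s -> hn s = derive1n n h s.
  elim: n => [|n [g [Cg gE]]]; first by exists h.
  have [g' Cg' g'E] := CD _ Cg.
  exists g'; split => // s Ds.
  have dh := near_eq_is_derive (near_eq _ _ _ gE Ds) (g'E s Ds).
  by rewrite derive1nS derive1E derive_val.
have [h' _ h'E] := CD _ Chn.
move=> t Dt.
by case: (near_eq_is_derive (near_eq _ _ _ hnE Dt) (h'E t Dt)).
Unshelve. all: by end_near. Qed.

Lemma near_eq_deriv (R : realType) (t : R) (f g f' g' : R -> R) :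
  (\forall s \near t, f s = g s) ->
  (\forall s \near t, is_derive s (1 : R) f (f' s)) ->
  (\forall s \near t, is_derive s (1 : R) g (g' s)) ->
  \forall s \near t, f' s = g' s.
Proof.
move=> /near_join fg df dg; near=> s.
have dfs : is_derive s (1 : R) f (f' s) by near: s.
have dgs : is_derive s (1 : R) g (g' s) by near: s.
rewrite -(@derive_val _ _ _ _ _ _ _ dfs) -(@derive_val _ _ _ _ _ _ _ dgs).
by apply: near_eq_derive; near: s.
Unshelve. all: by end_near. Qed.

(** For a polynomial expression the head symbol alone determines the rule of
    differentiation, so no search is needed; [dF] and [dA] differentiate the
    atoms. *)
Ltac differentiate_polynomial dF dA :=
  notypeclasses refine (is_derive_eq _ _);
  [ repeat lazymatch goal with
    | |- is_derive _ _ (_ + _) _ => notypeclasses refine (is_deriveD _ _)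
    | |- is_derive _ _ (_ * _) _ => notypeclasses refine (is_deriveM _ _)
    | |- is_derive _ _ (_ *: _) _ => notypeclasses refine (is_deriveZ _ _)
    | |- is_derive _ _ (_ ^+ _) _ => notypeclasses refine (is_deriveX _ _)
    | |- is_derive _ _ _ _ => first [exact (dF _) | exact (dA _)]
    end |].

(** Faa di Bruno's formula through order five, by differentiating the identity
    [G = Y \o F] near [t] five times.  This is the prolongation of a change of
    variables to the jets of order at most five. *)
Lemma faa_di_bruno5 (R : realType) (t : R) (G F Y : nat -> R -> R) :
  derivative_tower t G -> derivative_tower t F ->
  derivative_tower (F 0%N t) Y ->
  (\forall s \near t, G 0%N s = Y 0%N (F 0%N s)) ->
  let g n := G n t in let f n := F n t in let a n := Y n (F 0%N t) in
  [/\ g 1%N = a 1%N * f 1%N,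
      g 2%N = a 2%N * f 1%N ^+ 2 + a 1%N * f 2%N,
      g 3%N = a 3%N * f 1%N ^+ 3 + 3 * a 2%N * f 1%N * f 2%N + a 1%N * f 3%N,
      g 4%N = a 4%N * f 1%N ^+ 4 + 6 * a 3%N * f 1%N ^+ 2 * f 2%N
              + a 2%N * (4 * f 1%N * f 3%N + 3 * f 2%N ^+ 2) + a 1%N * f 4%N &
      g 5%N = a 5%N * f 1%N ^+ 5 + 10 * a 4%N * f 1%N ^+ 3 * f 2%N
              + a 3%N * (10 * f 1%N ^+ 2 * f 3%N + 15 * f 1%N * f 2%N ^+ 2)
              + a 2%N * (5 * f 1%N * f 4%N + 10 * f 2%N * f 3%N)
              + a 1%N * f 5%N].
Proof.
move=> tG tF tY eq0 g f a.
have F0cont : {for t, continuous (F 0%N)}.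
  have /(_ 0%N) [dF _] := nbhs_singleton tF.
  by apply: differentiable_continuous; apply/derivable1_diffP.
have dG n : \forall s \near t, is_derive s (1 : R) (G n) (G n.+1 s).
  by near=> s; exact: (near tG s).
(* Only the chain rule for the functions Y n \o F 0 matters, so the argument
   is carried out for any family A that obeys it. *)
have [A [dA A0 Aa]] : exists A : nat -> R -> R,
    [/\ \forall s \near t, forall n,
          is_derive s (1 : R) (A n) (A n.+1 s * F 1%N s),
        \forall s \near t, G 0%N s = A 0%N s & forall n, A n t = a n].
  exists (fun n => Y n \o F 0%N); split => //.
  near=> s => n; apply: is_derive1_comp; last exact: (near tF s).
  by move: n; near: s; exact: F0cont tY.
pose E1 : R -> R := A 1%N * F 1%N.
pose E2 : R -> R := A 2%N * F 1%N ^+ 2 + A 1%N * F 2%N.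
pose E3 : R -> R :=
  A 3%N * F 1%N ^+ 3 + 3 *: (A 2%N * F 1%N * F 2%N) + A 1%N * F 3%N.
pose E4 : R -> R :=
  A 4%N * F 1%N ^+ 4 + 6 *: (A 3%N * F 1%N ^+ 2 * F 2%N)
  + A 2%N * (4 *: (F 1%N * F 3%N) + 3 *: (F 2%N ^+ 2)) + A 1%N * F 4%N.
pose E5 : R -> R :=
  A 5%N * F 1%N ^+ 5 + 10 *: (A 4%N * F 1%N ^+ 3 * F 2%N)
  + A 3%N * (10 *: (F 1%N ^+ 2 * F 3%N) + 15 *: (F 1%N * F 2%N ^+ 2))
  + A 2%N * (5 *: (F 1%N * F 4%N) + 10 *: (F 2%N * F 3%N))
  + A 1%N * F 5%N.
have step n (e e' : R -> R) : (\forall s \near t, G n s = e s) ->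
    (\forall s \near t, is_derive s (1 : R) e (e' s)) ->
    \forall s \near t, G n.+1 s = e' s.
  by move=> He de; exact: near_eq_deriv He (dG n) de.
have eq1 : \forall s \near t, G 1%N s = E1 s.
  by apply: step A0 _; near=> s; exact: (near dA s).
have eq2 : \forall s \near t, G 2%N s = E2 s.
  apply: step eq1 _; near=> s.
  have dFs n : is_derive s (1 : R) (F n) (F n.+1 s) by move: n; near: s.
  have dAs n : is_derive s (1 : R) (A n) (A n.+1 s * F 1%N s).
    by move: n; near: s.
  rewrite /E1; differentiate_polynomial dFs dAs.
  rewrite /E2 !fctE /GRing.scale /=.
  by ring.
have eq3 : \forall s \near t, G 3%N s = E3 s.
  apply: step eq2 _; near=> s.
  have dFs n : is_derive s (1 : R) (F n) (F n.+1 s) by move: n; near: s.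
  have dAs n : is_derive s (1 : R) (A n) (A n.+1 s * F 1%N s).
    by move: n; near: s.
  rewrite /E2; differentiate_polynomial dFs dAs.
  rewrite /E3 !fctE /GRing.scale /=.
  by ring.
have eq4 : \forall s \near t, G 4%N s = E4 s.
  apply: step eq3 _; near=> s.
  have dFs n : is_derive s (1 : R) (F n) (F n.+1 s) by move: n; near: s.
  have dAs n : is_derive s (1 : R) (A n) (A n.+1 s * F 1%N s).
    by move: n; near: s.
  rewrite /E3; differentiate_polynomial dFs dAs.
  rewrite /E4 !fctE /GRing.scale /=.
  by ring.
have eq5 : \forall s \near t, G 5%N s = E5 s.
  apply: step eq4 _; near=> s.
  have dFs n : is_derive s (1 : R) (F n) (F n.+1 s) by move: n; near: s.
  have dAs n : is_derive s (1 : R) (A n) (A n.+1 s * F 1%N s).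
    by move: n; near: s.
  rewrite /E4; differentiate_polynomial dFs dAs.
  rewrite /E5 !fctE /GRing.scale /=.
  by ring.
split; rewrite /g /f -!Aa.
- exact: (nbhs_singleton eq1).
- exact: (nbhs_singleton eq2).
- by rewrite (nbhs_singleton eq3) /E3 !fctE /GRing.scale /=; ring.
- by rewrite (nbhs_singleton eq4) /E4 !fctE /GRing.scale /=; ring.
- by rewrite (nbhs_singleton eq5) /E5 !fctE /GRing.scale /=; ring.
Unshelve. all: by end_near. Qed.

(** * The inverse function theorem in the smooth class *)

(** By continuity the derivative does not vanish on a ball around [x], so by
    the mean value theorem [f] is injective there, and [g] can choose the
    preimage inside that ball. *)
Lemma local_left_inverse (R : realType) (x : R) (f f' : R -> R) :
  (\forall s \near x, is_derive s (1 : R) f (f' s)) ->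
  {for x, continuous f'} -> f' x != 0 ->
  exists g : R -> R, {near x, cancel f g}.
Proof.
move=> df f'c f'x.
have f'N0 : \forall s \near x, f' s != 0 by exact: cvgr_neq0 f'c f'x.
have : \forall s \near x, is_derive s (1 : R) f (f' s) /\ f' s != 0.
  exact: filterI df f'N0.
move=> /nbhs_ballP[e /= e0 eD].
have inj a b : ball x e a -> ball x e b -> f a = f b -> a = b.
  have lt_absurd a' b' : ball x e a' -> ball x e b' -> a' < b' ->
      f a' = f b' -> False.
    move=> xa xb ab fab.
    have D c : c \in `[a', b'] -> is_derive c (1 : R) f (f' c) /\ f' c != 0.
      move=> /itvP cab; apply: eD.
      move: xa xb; rewrite /ball /= !ltr_distlC => /andP[? ?] /andP[? ?].
      rewrite (lt_le_trans _ (_ : a' <= c)) ?cab//.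
      by rewrite (le_lt_trans (_ : c <= b')) ?cab.
    have dI c : c \in `]a', b'[ -> is_derive c (1 : R) f (f' c).
      by move=> /subset_itv_oo_cc /D[].
    have cI : {within `[a', b'], continuous f}.
      apply: continuous_in_subspaceT => c; rewrite inE => /D[dfc _].
      by apply: differentiable_continuous; apply/derivable1_diffP; case: dfc.
    have [c cab] := MVT ab dI cI.
    rewrite fab subrr => /esym/eqP; rewrite mulf_eq0 subr_eq0 (gt_eqF ab) orbF.
    by apply/negP; have [] := D c (subset_itv_oo_cc cab).
  move=> xa xb fab; have [ab|ba|//] := ltgtP a b.
  - by case: (lt_absurd a b).
  - by case: (lt_absurd b a).
exists (fun v => xget x [set s | ball x e s /\ f s = v]).
near=> s.
have xs : ball x e s by near: s; exact: nbhsx_ballx.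
case: xgetP => [r _ [xr frs]|/(_ s)/not_andP[]//].
exact: inj.
Unshelve. all: by end_near. Qed.

(** A class of functions stable under derivation when [g] is the inverse of a
    function with derivative [f'].  Since [g' = 1 / (f' \o g)], derivatives of
    composites with [g] bring in that inverse, whose own derivative is again a
    product of members; the generators cover every smooth [K] on [D] at once
    by taking whole towers. *)
Inductive inverse_algebra {R : realType} (D : set R) (f' g : R -> R) :
  (R -> R) -> Prop :=
| Ialg_comp K n :
    (forall s, D s -> forall m, is_derive s (1 : R) (K m) (K m.+1 s)) ->
    inverse_algebra D f' g (K n \o g)
| Ialg_inv : inverse_algebra D f' g (fun v => (f' (g v))^-1)
| Ialg_opp h : inverse_algebra D f' g h -> inverse_algebra D f' g (- h)
| Ialg_add h k : inverse_algebra D f' g h -> inverse_algebra D f' g k ->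
    inverse_algebra D f' g (h + k)
| Ialg_mul h k : inverse_algebra D f' g h -> inverse_algebra D f' g k ->
    inverse_algebra D f' g (h * k).

Lemma inverse_algebra_derive (R : realType) (D U : set R)
    (F : nat -> R -> R) (g : R -> R) :
  (forall s, D s -> forall m, is_derive s (1 : R) (F m) (F m.+1 s)) ->
  (forall v, U v -> [/\ D (g v), F 1%N (g v) != 0 &
    is_derive v (1 : R) g (F 1%N (g v))^-1]) ->
  forall h, inverse_algebra D (F 1%N) g h ->
  exists2 h', inverse_algebra D (F 1%N) g h' &
    forall v, U v -> is_derive v (1 : R) h (h' v).
Proof.
move=> dF gU h.
pose inv := fun v => (F 1%N (g v))^-1.
elim=> [K n dK||{}h _ [h' Ch' dh]|{}h k Ch [h' Ch' dh] Ck [k' Ck' dk]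
        |{}h k Ch [h' Ch' dh] Ck [k' Ck' dk]].
- exists ((K n.+1 \o g) * inv).
    by apply: Ialg_mul; [exact: Ialg_comp|exact: Ialg_inv].
  move=> v /gU[Dv _ dg]; apply: is_derive1_comp dg; exact: dK.
- exists (- (inv * inv * ((F 2%N \o g) * inv))).
    have Ci : inverse_algebra D (F 1%N) g inv by exact: Ialg_inv.
    apply: Ialg_opp; apply: Ialg_mul; first exact: Ialg_mul.
    by apply: Ialg_mul => //; exact: Ialg_comp.
  move=> v /gU[Dv N0 dg].
  have dFg := is_derive1_comp (dF _ Dv 1%N) dg.
  apply: is_derive_eq (is_deriveV N0 dFg) _.
  by rewrite /inv /GRing.scale !fctE /= -exprVn expr2 mulNr.
- exists (- h'); first exact: Ialg_opp.
  by move=> v Uv; apply: is_deriveN; exact: dh.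
- exists (h' + k'); first exact: Ialg_add.
  by move=> v Uv; apply: is_deriveD; [exact: dh|exact: dk].
- exists (h * k' + k * h'); first by apply: Ialg_add; exact: Ialg_mul.
  by move=> v Uv; apply: is_deriveM; [exact: dh|exact: dk].
Qed.

(** Composing the ordinate [K 0] with the inverse of the abscissa [F 0]
    eliminates the parameter of a curve [t |-> (F 0 t, K 0 t)].  The result is
    smooth because it belongs to [inverse_algebra], which is stable under
    derivation. *)
Lemma smooth_local_inverse (R : realType) (x : R) (F K : nat -> R -> R) :
  derivative_tower x F -> derivative_tower x K -> F 1%N x != 0 ->
  exists g : R -> R,
    [/\ {near x, cancel (F 0%N) g},
        {near F 0%N x, cancel g (F 0%N)},
        {for F 0%N x, continuous g} &
        exists2 U : set R, nbhs (F 0%N x) U & smooth_on U (K 0%N \o g)].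
Proof.
move=> tF tK F1x.
have F_cont n : \forall s \near x, {for s, continuous (F n)}.
  near=> s; apply: differentiable_continuous; apply/derivable1_diffP.
  by have [] : is_derive s (1 : R) (F n) (F n.+1 s) by exact: (near tF s).
have [g gK] : exists g : R -> R, {near x, cancel (F 0%N) g}.
  apply: (@local_left_inverse _ _ _ (F 1%N)) => //.
    by near=> s; exact: (near tF s).
  exact: nbhs_singleton (F_cont 1%N).
have [g_cont Kg] := near_can_continuousAcan_sym gK (F_cont 0%N).
exists g; split => //; first exact: nbhs_singleton g_cont.
have gx : g (F 0%N x) = x by exact: nbhs_singleton gK.
pose D : set R := [set s | forall n, is_derive s (1 : R) (F n) (F n.+1 s) /\
                                     is_derive s (1 : R) (K n) (K n.+1 s)].
have good : \forall s \near x, [/\ D s, F 1%N s != 0,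
    \forall r \near s, g (F 0%N r) = r &
    \forall r \near s, {for r, continuous (F 0%N)}].
  near=> s; split.
  - by move=> n; split; [exact: (near tF s)|exact: (near tK s)].
  - near: s; exact: cvgr_neq0 (nbhs_singleton (F_cont 1%N)) F1x.
  - by near: s; exact: (near_join gK).
  - by near: s; exact: (near_join (F_cont 0%N)).
have U0 : \forall v \near F 0%N x, [/\ D (g v), F 1%N (g v) != 0 &
    is_derive v (1 : R) g (F 1%N (g v))^-1].
  have gc := nbhs_singleton g_cont.
  have := gc _ _; rewrite gx => /(_ _ good).
  move: Kg; apply: filterS2 => v Kgv [Dv N0 can cont].
  split => //; rewrite -[X in is_derive X _ _ _]Kgv.
  by apply: is_derive_inverse => //; have [] := Dv 0%N.
exists (interior [set v | [/\ D (g v), F 1%N (g v) != 0 &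
    is_derive v (1 : R) g (F 1%N (g v))^-1]]).
  exact: nbhs_interior.
apply: (@smooth_on_derivation_closed _ _ (inverse_algebra D (F 1%N) g)).
- exact: open_interior.
- apply: inverse_algebra_derive; first by move=> s Ds m; have [] := Ds m.
  by move=> v /interior_subset.
by apply: Ialg_comp => s Ds m; have [] := Ds m.
Unshelve. all: by end_near. Qed.

(** * The graph in affine coordinates *)

(** The row [(a, b)] of an affine map centred at [(x, y x)], evaluated along
    the graph, together with all derivatives in the parameter.  Orders 0 and 1
    are special since the term [a * (t - x)] only survives there. *)
Definition moving_coord {R : realType} (y : R -> R) (x a b : R) (n : nat) :
    R -> R :=
  match n with
  | 0%N => fun t => a * (t - x) + b * (y t - y x)
  | 1%N => fun t => a + b * derive1n 1 y t
  | _ => fun t => b * derive1n n y t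
  end.

Lemma moving_coord_tower (R : realType) (y : R -> R) (x a b : R) :
  derivative_tower x (fun n => derive1n n y) ->
  derivative_tower x (moving_coord y x a b).
Proof.
apply: filterS => s dy [|n].
  have dy0 : is_derive s (1 : R) y (derive1n 1 y s) := dy 0%N.
  have -> : moving_coord y x a b 0%N = a *: (id - cst x) + b *: (y - cst (y x)).
    by apply/funext.
  have dF := is_deriveD
    (is_deriveZ a (is_deriveB (is_derive_id s 1) (is_derive_cst x s 1)))
    (is_deriveZ b (is_deriveB dy0 (is_derive_cst (y x) s 1))).
  by apply: is_derive_eq dF _; rewrite /GRing.scale /=; ring.
have dyn := dy n.+1.
have dby : is_derive s (1 : R) (b *: derive1n n.+1 y) (b * derive1n n.+2 y s).
  exact: is_deriveZ.
case: n dyn dby => [|n] dyn dby; last exact: dby.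
have -> : moving_coord y x a b 1%N = cst a + b *: derive1n 1 y by apply/funext.
by apply: is_derive_eq (is_deriveD (is_derive_cst a s 1) dby) _; rewrite add0r.
Qed.

Lemma moving_coord_center (R : realType) (y : R -> R) (x a b : R) :
  moving_coord y x a b 0%N x = 0.
Proof. by rewrite /= !subrr !mulr0 addr0. Qed.

Lemma affine_map_graph_pt (R : realType) (A : 'M[R]_2) (y : R -> R) (x t : R)
    (i : 'I_2) :
  affine_map A (pt x (y x)) (pt t (y t)) i 0
  = A i 0 * (t - x) + A i 1 * (y t - y x).
Proof.
rewrite /affine_map !mxE big_ord_recl big_ord1 /= !mxE /=.
by rewrite (_ : lift ord0 ord0 = 1) //; apply: val_inj.
Qed.

Lemma det_mx22 (R : realType) (A : 'M[R]_2) :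
  \det A = A 0 0 * A 1 1 - A 0 1 * A 1 0.
Proof.
have l01 : lift ord0 ord0 = 1 :> 'I_2 by exact: val_inj.
have l10 : lift 1 ord0 = 0 :> 'I_2 by exact: val_inj.
rewrite (expand_det_row _ 0) big_ord_recl big_ord1 /cofactor !det_mx11 !mxE.
by rewrite l01 l10 /= expr0 mul1r expr1 mulN1r mulrN.
Qed.

Lemma cV2_eq (R : realType) (Z W : 'cV[R]_2) :
  Z 0 0 = W 0 0 -> Z 1 0 = W 1 0 -> Z = W.
Proof.
move=> ZW0 ZW1; apply/matrixP => i j; rewrite ord1.
by case: i => [[|[|//]]] Hi; [move: ZW0 | move: ZW1];
   congr (_ = _); congr (_ _ _); apply: val_inj.
Qed.

(** From sets to functions: points of the curve with parameter near [x] are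
    sent near the origin, where the image is the graph of [Y].  The resulting
    functional identity can be differentiated. *)
Lemma near_graph_moving_coord (R : realType) (I : set R) (A : 'M[R]_2)
    (x : R) (y Y : R -> R) :
  nbhs x I -> derivative_tower x (fun n => derive1n n y) ->
  near_origin_graph (affine_map A (pt x (y x)) @` graph_over I y) Y ->
  \forall t \near x, moving_coord y x (A 1 0) (A 1 1) 0%N t
                     = Y (moving_coord y x (A 0 0) (A 0 1) 0%N t).
Proof.
move=> xI ty [_ gY].
have cont a b : moving_coord y x a b 0%N t @[t --> x] --> (0 : R).
  have := nbhs_singleton (moving_coord_tower a b ty).
  move=> /(_ 0%N)[dm _].
  rewrite -[X in _ --> X](moving_coord_center y x a b).
  by apply: differentiable_continuous; apply/derivable1_diffP.
have /nbhs_ballP[e /= e0 eY] := gY.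
near=> t.
rewrite -!affine_map_graph_pt; apply/eY; last first.
  by exists (pt t (y t)) => //; exists t => //; near: t.
split=> // i j; rewrite ord1 mxE affine_map_graph_pt.
rewrite /ball /= sub0r normrN.
case: i => [[|[|//]]] Hi.
- rewrite (_ : Ordinal Hi = 0); last exact: val_inj.
  by near: t; apply: (cvgr0_norm_lt _ (cont _ _)).
- rewrite (_ : Ordinal Hi = 1); last exact: val_inj.
  by near: t; apply: (cvgr0_norm_lt _ (cont _ _)).
Unshelve. all: by end_near. Qed.

(** From functions to sets: when the new abscissa has non-zero derivative at
    [x], the transformed curve is a graph near the origin.  Injectivity of the
    affine map is essential: it forces every point of the image near the origin
    to come from a parameter near [x], where the abscissa is invertible, so no
    remote branch of the curve can return there. *)
Lemma near_origin_graph_inverse (R : realType) (I : set R) (A : 'M[R]_2)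
    (x : R) (y : R -> R) :
  nbhs x I -> derivative_tower x (fun n => derive1n n y) -> \det A != 0 ->
  moving_coord y x (A 0 0) (A 0 1) 1%N x != 0 ->
  exists Y, near_origin_graph (affine_map A (pt x (y x)) @` graph_over I y) Y.
Proof.
move=> xI ty detA u0.
set F := moving_coord y x (A 0 0) (A 0 1) in u0 *.
pose K := moving_coord y x (A 1 0) (A 1 1).
have [g [Fg gF gc [U U0 Usmooth]]] := smooth_local_inverse
  (moving_coord_tower _ _ ty) (moving_coord_tower (A 1 0) (A 1 1) ty) u0.
have Fx0 : F 0%N x = 0 by exact: moving_coord_center.
have gx : g (F 0%N x) = x by exact: nbhs_singleton Fg.
rewrite -/F Fx0 in gF gc gx U0.
exists (K 0%N \o g); split; first by exists U.
have detE : \det A = A 0 0 * A 1 1 - A 0 1 * A 1 0 by exact: det_mx22.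
(* The parameter of a point of the image: the first coordinate of the inverse
   affine map, by Cramer's rule. *)
pose tau (Z : 'cV[R]_2) := x + (A 1 1 * Z 0 0 - A 0 1 * Z 1 0) / \det A.
have coord0 i : (fun Z : 'cV[R]_2 => Z i 0) @ (0 : 'cV[R]_2) --> (0 : R).
  have := @coord_continuous R 2 1 i 0 (0 : 'cV[R]_2).
  by rewrite /continuous_at mxE; apply.
have tau_cvg : tau @ (0 : 'cV[R]_2) --> x.
  have := cvgD (cvg_cst x) (cvgMr_tmp (b := (\det A)^-1)
    (cvgB (cvgMl_tmp (a := A 1 1) (coord0 0))
          (cvgMl_tmp (a := A 0 1) (coord0 1)))).
  by rewrite !mulr0 subrr mul0r addr0; apply.
have nI : \forall Z \near (0 : 'cV[R]_2), I (g ((Z : 'cV[R]_2) 0 0)).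
  by apply: (cvg_comp _ _ (coord0 0) gc); rewrite gx.
have nF : \forall Z \near (0 : 'cV[R]_2),
    F 0%N (g ((Z : 'cV[R]_2) 0 0)) = Z 0 0.
  exact: (coord0 0 _ gF).
have nt : \forall Z \near (0 : 'cV[R]_2), g (F 0%N (tau Z)) = tau Z.
  exact: (tau_cvg _ Fg).
near=> Z; split.
- move=> [_ [t It <-] ZE].
  have Z0 : Z 0 0 = F 0%N t by rewrite -ZE affine_map_graph_pt.
  have Z1 : Z 1 0 = K 0%N t by rewrite -ZE affine_map_graph_pt.
  have tE : tau Z = t.
    rewrite /tau Z0 Z1 /F /K /= detE; field.
    by rewrite -detE.
  have : g (F 0%N (tau Z)) = tau Z by near: Z.
  by rewrite tE -Z0 /= Z1 => ->.
- move=> Z1; exists (pt (g (Z 0 0)) (y (g (Z 0 0)))).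
    by exists (g (Z 0 0)) => //; near: Z.
  apply: cV2_eq; rewrite affine_map_graph_pt; last by rewrite Z1.
  by near: Z.
Unshelve. all: by end_near. Qed.

(** * Solving the normalization equations *)

(** With [v] the positive quantity determined by the fourth-order
    normalization, [|S|] to the power [3/2] is [3 * sqrt 3 * v ^ 3], which
    turns the rational expression [N / (9 * v ^ 3)] into the announced one. *)
Lemma curvature_closed_form (R : realType) (S N k v : R) :
  0 < v -> 3 * v ^+ 2 = `|S| -> 9 * v ^+ 3 * k = N ->
  k = Num.sqrt 3 * N / (3 * `|S| `^ (3 / 2)).
Proof.
move=> v0 <- <-.
have s3 : Num.sqrt (3 : R) ^+ 2 = 3 by rewrite sqr_sqrtr.
have s0 : 0 < Num.sqrt (3 : R) by rewrite sqrtr_gt0.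
have -> : (3 * v ^+ 2) `^ (3 / 2) = (Num.sqrt 3 * v) ^+ 3.
  have sv0 : 0 <= Num.sqrt 3 * v by rewrite mulr_ge0// ltW.
  have -> : 3 * v ^+ 2 = (Num.sqrt 3 * v) `^ 2%:R.
    by rewrite powR_mulrn// exprMn s3.
  by rewrite -powRrM [2%:R * _]mulrC divfK// powR_mulrn.
rewrite exprMn (exprS (Num.sqrt 3) 2) s3; field.
by rewrite !gt_eqF.
Qed.

(** Here [p, q, r, s, w] are the derivatives of the curve at the point and the
    [a_i] those of the normalized graph, linked by Faa di Bruno's formula.
    Orders one to three give [c], [d] and [b] in terms of [u]; order four gives
    [3 * a4 * (q * u) ^ 2 = S] with [S = 3 * q * s - 5 * r ^ 2], and order five
    [9 * (q * u) ^ 3 * a5 = N] with [N] the cubic expression of the formula.  The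
    condition [det A > 0] selects the sign [q * u > 0]; without it the curvature
    would only be determined up to sign. *)
Lemma normal_form_curvature (R : realType) (p q r s w a b c d : R)
    (a1 a2 a3 a4 a5 : R) :
  q != 0 -> 0 < a * d - b * c ->
  let u := a + b * p in
  a1 = 0 -> a2 = 1 -> a3 = 0 -> a4 = 1 \/ a4 = -1 ->
  c + d * p = a1 * u ->
  d * q = a2 * u ^+ 2 + a1 * (b * q) ->
  d * r = a3 * u ^+ 3 + 3 * a2 * u * (b * q) + a1 * (b * r) ->
  d * s = a4 * u ^+ 4 + 6 * a3 * u ^+ 2 * (b * q)
          + a2 * (4 * u * (b * r) + 3 * (b * q) ^+ 2) + a1 * (b * s) ->
  d * w = a5 * u ^+ 5 + 10 * a4 * u ^+ 3 * (b * q)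
          + a3 * (10 * u ^+ 2 * (b * r) + 15 * u * (b * q) ^+ 2)
          + a2 * (5 * u * (b * s) + 10 * (b * q) * (b * r)) + a1 * (b * w) ->
  a5 = Num.sqrt 3 * (9 * q ^+ 2 * w - 45 * q * r * s + 40 * r ^+ 3)
       / (3 * (`|3 * q * s - 5 * r ^+ 2| `^ (3 / 2))).
Proof.
set N := 9 * _ * w - _ + _; set S := 3 * q * s - _.
move=> q0 det_gt0 u -> -> -> e1.
rewrite !mulr0 !mul0r !addr0 !mul1r mulr1 add0r => cE dq dr ds dw.
have du_gt0 : 0 < d * u.
  by move: det_gt0; rewrite (_ : c = - (d * p)) /u; [nra|lra].
have u0 : u != 0 by apply: contraTneq du_gt0 => ->; rewrite mulr0 ltxx.
have dE : d = u ^+ 2 / q by rewrite -dq mulfK.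
have bE : b = u * r / (3 * q ^+ 2).
  apply: (mulfI (mulf_neq0 u0 q0)).
  have -> : u * q * b = d * r / 3 by rewrite dr; field.
  by rewrite dE; field.
(* The fourth-order equation, cleared of denominators; the two terms in r^2
   add up to 5 r^2. *)
have SE : 3 * a4 * (q * u) ^+ 2 = S.
  apply: (mulfI (expf_neq0 2 u0)).
  have -> : u ^+ 2 * (3 * a4 * (q * u) ^+ 2)
    = 3 * q ^+ 2 * (d * s - (4 * u * (b * r) + 3 * (b * q) ^+ 2)).
    by rewrite ds; ring.
  by rewrite dE bE /S; field.
(* The fifth-order equation, with a4 eliminated by means of SE. *)
have NE : 9 * (q * u) ^+ 3 * a5 = N.
  apply: (mulfI (expf_neq0 2 u0)).
  have -> : u ^+ 2 * (9 * (q * u) ^+ 3 * a5)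
    = 9 * q ^+ 3 * (d * w - (5 * u * (b * s) + 10 * (b * q) * (b * r)))
      - 30 * b * q ^+ 2 * u * (3 * a4 * (q * u) ^+ 2).
    by rewrite dw; ring.
  by rewrite SE dE bE /S /N; field.
apply: curvature_closed_form NE; last first.
  rewrite -SE; have := sqr_ge0 (q * u).
  by case: e1 => -> ?;
     rewrite ?mulrN1 ?mulNr ?normrN ?mulr1 ger0_norm// mulr_ge0.
(* q u has the sign of d u, since d q = u^2. *)
have : 0 < d * u * (q ^+ 2) by rewrite mulr_gt0// exprn_even_gt0.
rewrite (_ : _ * _ = u ^+ 2 * (q * u)); last by rewrite -dq; ring.
by rewrite (pmulr_rgt0 _ (_ : 0 < u ^+ 2)) ?exprn_even_gt0.
Qed.

(** The same equations read backwards.  The choice [u = v / q] with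
    [v = sqrt (|S| / 3)] is dictated by the fourth-order normalization, and
    then [d], [b], [c] follow from orders two, three and one.  The determinant
    is [v ^ 3 / q ^ 4], positive for either sign of [q].  The conclusion
    speaks of arbitrary [a_i] because the normalized graph is only known
    through the equations its derivatives satisfy. *)
Lemma normal_form_exists (R : realType) (p q r s : R) :
  q != 0 -> 3 * q * s - 5 * r ^+ 2 != 0 ->
  exists a b c d : R, [/\ 0 < a * d - b * c, a + b * p != 0 &
    let u := a + b * p in
    forall a1 a2 a3 a4 : R,
    c + d * p = a1 * u ->
    d * q = a2 * u ^+ 2 + a1 * (b * q) ->
    d * r = a3 * u ^+ 3 + 3 * a2 * u * (b * q) + a1 * (b * r) ->
    d * s = a4 * u ^+ 4 + 6 * a3 * u ^+ 2 * (b * q)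
            + a2 * (4 * u * (b * r) + 3 * (b * q) ^+ 2) + a1 * (b * s) ->
    [/\ a1 = 0, a2 = 1, a3 = 0 & a4 = 1 \/ a4 = -1]].
Proof.
set S := 3 * q * s - _ => q0 S0.
pose v := Num.sqrt (`|S| / 3).
have v_gt0 : 0 < v by rewrite sqrtr_gt0 divr_gt0 ?normr_gt0.
have v0 : v != 0 by rewrite gt_eqF.
have v2 : 3 * v ^+ 2 = `|S|.
  by rewrite sqr_sqrtr ?divr_ge0//; field.
pose u := v / q; pose d := u ^+ 2 / q; pose b := u * r / (3 * q ^+ 2).
have u0 : u != 0 by rewrite mulf_neq0// invr_eq0.
exists (u - b * p), b, (- (d * p)), d; rewrite subrK; split => //.
  have -> : (u - b * p) * d - b * - (d * p) = v ^+ 3 / q ^+ 4.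
    by rewrite /d /u; field.
  by rewrite divr_gt0 ?(exprn_gt0 3 v_gt0)// exprn_even_gt0.
move=> /= a1 a2 a3 a4 E1.
have -> : a1 = 0.
  by apply: (mulIf u0); rewrite -E1 mul0r addNr.
rewrite !mul0r !addr0 => E2.
have -> : a2 = 1.
  by apply: (mulIf (expf_neq0 2 u0)); rewrite -E2 /d; field.
move=> E3.
have -> : a3 = 0.
  apply: (mulIf (expf_neq0 3 u0)).
  rewrite mul0r -[LHS](addrK (3 * 1 * u * (b * q))) -E3 /d /b; field.
  exact: q0.
rewrite mulr0 !mul0r addr0 mul1r => E4.
split => //.
have : a4 * (3 * v ^+ 2) = S.
  apply: (mulfI (expf_neq0 2 u0)).
  have -> : u ^+ 2 * (a4 * (3 * v ^+ 2))
    = 3 * q ^+ 2 * (d * s - (4 * u * (b * r) + 3 * (b * q) ^+ 2)).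
    rewrite E4 (_ : v = u * q); last by rewrite /u mulfVK.
    by ring.
  by rewrite /d /b /S; field.
rewrite v2; case: (ger0P S) => _ aS; [left|right]; apply: (mulIf S0).
  by rewrite mul1r.
by rewrite mulN1r -[in RHS]aS mulrN opprK.
Qed.

(** * The affine curvature of a graph *)

(** Whatever normalizing map is used, the derivatives of the normalized graph
    obey Faa di Bruno's formula, whose solution leaves a single value. *)
Lemma affine_curvature_value (R : realType) (I : set R) (y : R -> R) (x k : R) :
  nbhs x I -> smooth_on I y -> derive1n 2 y x != 0 ->
  is_affine_curvature (graph_over I y) (pt x (y x)) k ->
  k = Num.sqrt 3 *
        (9 * derive1n 2 y x ^+ 2 * derive1n 5 y x
         - 45 * derive1n 2 y x * derive1n 3 y x * derive1n 4 y x
         + 40 * derive1n 3 y x ^+ 3)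
      / (3 * (`|3 * derive1n 2 y x * derive1n 4 y x
                - 5 * derive1n 3 y x ^+ 2| `^ (3 / 2))).
Proof.
move=> xI Iy q0 [A [Y [detA AY [Y0 Y1 Y2 Y3 Y4] <-]]].
have ty := smooth_on_tower xI Iy.
have Fx0 : moving_coord y x (A 0 0) (A 0 1) 0%N x = 0.
  exact: moving_coord_center.
have tY : derivative_tower (moving_coord y x (A 0 0) (A 0 1) 0%N x)
    (fun n => derive1n n Y).
  by rewrite Fx0; case: AY => -[U U0 UY] _; exact: smooth_on_tower U0 UY.
have := faa_di_bruno5 (moving_coord_tower (A 1 0) (A 1 1) ty)
  (moving_coord_tower _ _ ty) tY (near_graph_moving_coord xI ty AY).
cbv beta zeta; rewrite Fx0 => -[E1 E2 E3 E4 E5].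
move: detA; rewrite det_mx22 => detA.
exact: normal_form_curvature q0 detA Y1 Y2 Y3 Y4 E1 E2 E3 E4 E5.
Qed.

(** The normalizing matrix is chosen from the jet of [y] alone; the graph it
    produces comes from the inverse function theorem, and its derivatives are
    then forced to be the normalized ones. *)
Lemma affine_curvature_exists (R : realType) (I : set R) (y : R -> R) (x : R) :
  nbhs x I -> smooth_on I y -> regular y x ->
  exists k, is_affine_curvature (graph_over I y) (pt x (y x)) k.
Proof.
move=> xI Iy [q0 S0].
have ty := smooth_on_tower xI Iy.
have [a [b [c [d [det_gt0 u0 solve]]]]] :=
  normal_form_exists (derive1n 1 y x) q0 S0.
pose A : 'M[R]_2 := \matrix_(i < 2, j < 2)
  if i == 0 then if j == 0 then a else b else if j == 0 then c else d.
have [A00 A01 A10 A11] : [/\ A 0 0 = a, A 0 1 = b, A 1 0 = c & A 1 1 = d].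
  by split; rewrite mxE.
have detA : 0 < \det A by rewrite det_mx22 A00 A01 A10 A11.
have [Y AY] : exists Y,
    near_origin_graph (affine_map A (pt x (y x)) @` graph_over I y) Y.
  apply: near_origin_graph_inverse => //; first by rewrite gt_eqF.
  by rewrite A00 A01.
exists (derive1n 5 Y 0), A, Y; split => //.
have Fx0 : moving_coord y x a b 0%N x = 0.
  exact: moving_coord_center.
have tY : derivative_tower (moving_coord y x a b 0%N x) (fun n => derive1n n Y).
  by rewrite Fx0; case: AY => -[U U0 UY] _; exact: smooth_on_tower U0 UY.
have nY := near_graph_moving_coord xI ty AY.
rewrite A00 A01 A10 A11 in nY.
have := faa_di_bruno5 (moving_coord_tower _ _ ty)
  (moving_coord_tower _ _ ty) tY nY.
cbv beta zeta; rewrite Fx0 => -[E1 E2 E3 E4 _].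
have [Y1 Y2 Y3 Y4] := solve _ _ _ _ E1 E2 E3 E4.
split => //.
by have := nbhs_singleton nY; rewrite !moving_coord_center.
Qed.

Theorem theorem4p1 (R : realType) (I : set R) (y : R -> R) (x : R)
    (I_open : open I) (I_interval : is_interval I)
    (y_smooth : smooth_on I y) (x_in_I : I x) (P_regular : regular y x) :
  forall k : R,
    is_affine_curvature (graph_over I y) (pt x (y x)) k <->
    k = Num.sqrt 3 *
          (9 * derive1n 2 y x ^+ 2 * derive1n 5 y x
           - 45 * derive1n 2 y x * derive1n 3 y x * derive1n 4 y x
           + 40 * derive1n 3 y x ^+ 3)
        / (3 * (`|3 * derive1n 2 y x * derive1n 4 y x
                  - 5 * derive1n 3 y x ^+ 2| `^ (3 / 2))).
Proof.
have xI : nbhs x I by apply: open_nbhs_nbhs.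
have [q0 _] := P_regular.
move=> k; split; first exact: affine_curvature_value xI y_smooth q0.
have [k0 k0C] := affine_curvature_exists xI y_smooth P_regular.
by rewrite -(affine_curvature_value xI y_smooth q0 k0C) => ->.
Qed.
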